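(* $$\sum_{i=1}^{\infty } \frac{\sum_{j=1}^i \frac{1}{j^2}}{(1+2 i) \binom{2 i}{i}}= \frac{\pi ^3}{81 \sqrt{3}}.$$
   Context: $\binom{2i}{i}$ is the central binomial coefficient; the outer sum is a convergent series of real numbers. *)

(* Defs.v *)
From Stdlib Require Import Reals.
From Coquelicot Require Import Coquelicot.

(* Main.v *)
Require Import Defs.
From Stdlib Require Import Reals.
From Coquelicot Require Import Coquelicot.
From Stdlib Require Import Lra Lia.
Open Scope R_scope.

(** The series is a value of the expansion of a cubic in an arcsine.  With
    [x = sin t], the functions [mode n t = arcsin_coef n * cos t * sin t ^ (2n+1)]
    satisfy [t = sum_n mode n t] (the classical series of
    [arcsin x / sqrt (1 - x^2)]), and the point is that inserting the weights
    [harmonic2 n = sum_(1 <= j <= n) 1 / j^2] turns [t] into [2/3 t^3].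
    At [t = PI/6], where [sin t = 1/2] and the powers of [sin t] cancel the [4 ^ n]
    of [arcsin_coef n], the term [mode n t] is
    [sqrt 3 / 4 / ((2n+1) C(2n,n))], which gives the stated sum
    [4 / sqrt 3 * 2/3 * (PI/6)^3].

    Both expansions come from the three-term relation
    [mode n'' = (2n)^2 mode (n-1) - (2n+2)^2 mode n] (lemma [mode'_derive]).
    Summing by parts against weights [w] (lemma [sum_mode'']), the second
    derivative of [sum_(n <= N) w n * mode n] is
    [sum_(n <= N) (w (n+1) - w n) (2n+2)^2 mode n] minus one boundary term.
    For [w = 1] only the boundary term remains, so the sum is close to the
    linear function [t] with the same value and slope at the origin.  For [w = harmonic2] the factor [(2n+2)^2] cancels the increment
    [1 / (n+1)^2] up to [4], so the second derivative is close to
    [4 * sum_n mode n], that is to [4 t], whence [2/3 t^3].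
    On [[0, PI/6]] one has [0 <= sin t <= 1/2], the boundary terms decay
    geometrically, and integrating twice keeps the bound (lemma
    [bound_of_derive2]). *)

(** * The modes and their second derivatives *)

(** The coefficient of [x ^ (2n+1)] in [arcsin x / sqrt (1 - x^2)]. *)
Definition arcsin_coef (n : nat) : R :=
  4 ^ n / ((1 + 2 * INR n) * Binomial.C (2 * n) n).

Definition mode (n : nat) (t : R) : R := arcsin_coef n * (cos t * sin t ^ (2 * n + 1)).

Definition mode' (n : nat) (t : R) : R :=
  arcsin_coef n * ((2 * INR n + 1) * sin t ^ (2 * n)
         - (2 * INR n + 2) * sin t ^ (2 * n + 2)).

Lemma C_neq0 (n : nat) : Binomial.C (2 * n) n <> 0.
Proof.
unfold Binomial.C; replace (2 * n - n)%nat with n by lia.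
apply Rgt_not_eq, Rdiv_lt_0_compat; [|apply Rmult_lt_0_compat]; apply INR_fact_lt_0.
Qed.

Lemma central_binomial_S (n : nat) :
  (INR n + 1) * Binomial.C (2 * S n) (S n)
  = 2 * (1 + 2 * INR n) * Binomial.C (2 * n) n.
Proof.
unfold Binomial.C.
replace (2 * S n - S n)%nat with (S n) by lia.
replace (2 * n - n)%nat with n by lia.
replace (2 * S n)%nat with (S (S (2 * n))) by lia.
rewrite !fact_simpl, !mult_INR, !S_INR, mult_INR; simpl (INR 2).
assert (Hf := INR_fact_neq_0 n); assert (Hn := pos_INR n).
field; split; assumption || lra.
Qed.

Lemma arcsin_coef_S (n : nat) :
  (2 * INR n + 3) * arcsin_coef (S n) = (2 * INR n + 2) * arcsin_coef n.
Proof.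
unfold arcsin_coef; assert (Hn := pos_INR n).
assert (HS : Binomial.C (2 * S n) (S n)
   = 2 * (1 + 2 * INR n) * Binomial.C (2 * n) n / (INR n + 1)).
{ rewrite <- central_binomial_S; field; lra. }
rewrite HS, S_INR; simpl pow.
assert (HC := C_neq0 n); field; repeat split; assumption || lra.
Qed.

Lemma arcsin_coef_0 : arcsin_coef 0 = 1.
Proof. unfold arcsin_coef, Binomial.C; simpl; field. Qed.

Lemma arcsin_coef_bound (n : nat) : 0 <= arcsin_coef n <= 1.
Proof.
induction n as [|n IH]; [rewrite arcsin_coef_0; lra|].
assert (Hn := pos_INR n); assert (Ha := arcsin_coef_S n).
assert (HS : arcsin_coef (S n) = (2 * INR n + 2) / (2 * INR n + 3) * arcsin_coef n).
{ apply Rmult_eq_reg_l with (2 * INR n + 3); [rewrite Ha; field|]; lra. }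
assert (0 <= (2 * INR n + 2) / (2 * INR n + 3) <= 1).
{ split; [apply Rdiv_le_0_compat; lra|apply Rle_div_l; lra]. }
rewrite HS; nra.
Qed.

Lemma mode_derive (n : nat) (t : R) : is_derive (mode n) t (mode' n t).
Proof.
unfold mode, mode'.
evar_last.
- auto_derive; [exact I|reflexivity].
- (* [auto_derive] leaves [2 * n] reduced. *)
  change (n + (n + 0))%nat with (2 * n)%nat.
  replace (Nat.pred (2 * n + 1)) with (2 * n)%nat by lia.
  rewrite !pow_add, plus_INR, mult_INR; simpl (INR 2); simpl (INR 1).
  assert (Hc : cos t * cos t = 1 - sin t * sin t)
    by (assert (Hp := sin2_cos2 t); unfold Rsqr in Hp; lra).
  simpl (_ ^ 1); simpl (_ ^ 2).
  transitivity (arcsin_coef n * ((2 * INR n + 1) * sin t ^ (2 * n) * (cos t * cos t)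
     - sin t ^ (2 * n) * (sin t * sin t))); [ring|rewrite Hc; ring].
Qed.

(** For [n = 0] the truncated index [n - 1 = 0] is harmless, its factor being 0. *)
Definition mode'' (n : nat) (t : R) : R :=
  (2 * INR n) ^ 2 * mode (n - 1) t - (2 * INR n + 2) ^ 2 * mode n t.

(** The powers [sin t ^ (2n-1)] produced by differentiating [mode' n] carry the
    coefficient [2n (2n+1) * arcsin_coef n], which [arcsin_coef_S] turns into
    [(2n)^2 * arcsin_coef (n-1)]: the second derivative falls back on [mode (n-1)]. *)
Lemma mode'_derive (n : nat) (t : R) : is_derive (mode' n) t (mode'' n t).
Proof.
unfold mode', mode'', mode.
evar_last.
- auto_derive; [exact I|reflexivity].
- (* [auto_derive] leaves [2 * n] reduced. *)
  change (n + (n + 0))%nat with (2 * n)%nat.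
  destruct n as [|m].
  + simpl; rewrite arcsin_coef_0; ring.
  + replace (Nat.pred (2 * S m + 2)) with (2 * S m + 1)%nat by lia.
    replace (Nat.pred (2 * S m)) with (2 * m + 1)%nat by lia.
    replace (S m - 1)%nat with m by lia.
    rewrite plus_INR, mult_INR; simpl (INR 2); rewrite S_INR.
    assert (Ha := arcsin_coef_S m).
    transitivity (2 * (INR m + 1) * ((2 * INR m + 3) * arcsin_coef (S m))
        * (cos t * sin t ^ (2 * m + 1))
      - (2 * INR m + 4) ^ 2 * arcsin_coef (S m) * (cos t * sin t ^ (2 * S m + 1)));
    [ring|rewrite Ha; ring].
Qed.

(** * Weighted sums of modes *)

Lemma sum_n_derive (w : nat -> R) (f f' : nat -> R -> R) (N : nat) (t : R) :
  (forall n, is_derive (f n) t (f' n t)) ->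
  is_derive (fun u => sum_n (fun n => w n * f n u) N) t
    (sum_n (fun n => w n * f' n t) N).
Proof.
intros Hf.
apply (is_derive_sum_n (fun n u => w n * f n u)); intros n _.
apply is_derive_scal, Hf.
Qed.

(** The next lemmas restate facts on sums with their equality at type [R] rather
    than in a generic module, so that [ring] and [field] recognize it. *)
Lemma sum_n_0_R (u : nat -> R) : sum_n u 0 = u 0%nat :> R.
Proof. exact (sum_O u). Qed.

Lemma sum_n_S_R (u : nat -> R) (N : nat) :
  sum_n u (S N) = sum_n u N + u (S N) :> R.
Proof. exact (sum_Sn u N). Qed.

Lemma sum_n_ext_R (u v : nat -> R) (N : nat) :
  (forall n, u n = v n) -> sum_n u N = sum_n v N :> R.
Proof. exact (sum_n_ext u v N). Qed.

Lemma sum_n_mult_l_R (c : R) (u : nat -> R) (N : nat) :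
  sum_n (fun n => c * u n) N = c * sum_n u N :> R.
Proof. exact (sum_n_mult_l c u N). Qed.

(** Summation by parts of the three-term relation. *)
Lemma sum_mode'' (w : nat -> R) (N : nat) (t : R) :
  sum_n (fun n => w n * mode'' n t) N
  = sum_n (fun n => (w (S n) - w n) * (2 * INR n + 2) ^ 2 * mode n t) N
    - w (S N) * (2 * INR N + 2) ^ 2 * mode N t :> R.
Proof.
induction N as [|N IH].
- rewrite !sum_n_0_R; unfold mode''; simpl INR; ring.
- rewrite !sum_n_S_R, IH; unfold mode'' at 1.
  replace (S N - 1)%nat with N by lia.
  rewrite S_INR; ring.
Qed.

Lemma sum_mode_0 (w : nat -> R) (N : nat) : sum_n (fun n => w n * mode n 0) N = 0 :> R.
Proof.
induction N as [|N IH]; [rewrite sum_n_0_R|rewrite sum_n_S_R, IH];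
unfold mode; rewrite sin_0, pow_i by lia; ring.
Qed.

(** Only [mode 0] has a nonzero slope at the origin. *)
Lemma sum_mode'_0 (w : nat -> R) (N : nat) :
  sum_n (fun n => w n * mode' n 0) N = w 0%nat :> R.
Proof.
induction N as [|N IH].
- rewrite sum_n_0_R; unfold mode'; rewrite sin_0, arcsin_coef_0; simpl; ring.
- rewrite sum_n_S_R, IH; unfold mode'; rewrite sin_0, !pow_i by lia.
  ring.
Qed.

(** * Uniform approximation on [[0, PI/6]] *)

Lemma bound_of_derive (f f' : R -> R) (T M : R) :
  T <= 1 -> (forall u, is_derive f u (f' u)) -> f 0 = 0 ->
  (forall u, 0 <= u <= T -> Rabs (f' u) <= M) ->
  forall u, 0 <= u <= T -> Rabs (f u) <= M.
Proof.
intros HT Hd H0 Hb u Hu.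
destruct (MVT_gen f 0 u f') as [c [Hc Heq]].
- intros; apply Hd.
- intros x _; apply continuity_pt_filterlim, (@ex_derive_continuous R_AbsRing).
  eexists; apply Hd.
- rewrite Rmin_left, Rmax_right in Hc by lra.
  rewrite H0 in Heq.
  replace (f u) with (f' c * u) by lra.
  rewrite Rabs_mult, (Rabs_pos_eq u) by lra.
  assert (HM := Hb c ltac:(lra)); assert (Hp := Rabs_pos (f' c)); nra.
Qed.

(** The comparison principle that replaces solving the differential equations: a
    function with zero initial data is controlled by its second derivative. *)
Lemma bound_of_derive2 (f f' f'' : R -> R) (T M : R) :
  T <= 1 -> (forall u, is_derive f u (f' u)) ->
  (forall u, is_derive f' u (f'' u)) -> f 0 = 0 -> f' 0 = 0 ->
  (forall u, 0 <= u <= T -> Rabs (f'' u) <= M) ->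
  forall u, 0 <= u <= T -> Rabs (f u) <= M.
Proof.
intros HT Hd Hd' H0 H0' Hb.
apply (bound_of_derive f f'); auto.
now apply (bound_of_derive f' f'').
Qed.

Lemma PI6_le_1 : PI / 6 <= 1.
Proof. assert (Hp := PI_4); lra. Qed.

(** A bound for the boundary term [(2N+2)^2 * mode N t], using
    [sin t ^ (2N+1) <= (1/4) ^ N]. *)
Definition tail_bound (N : nat) : R := 4 * INR (S N) ^ 2 * (1 / 4) ^ N.

Lemma mode_bound (N : nat) (t : R) : 0 <= t <= PI / 6 ->
  Rabs ((2 * INR N + 2) ^ 2 * mode N t) <= tail_bound N.
Proof.
intros Ht; assert (Hpi := PI_RGT_0); unfold mode, tail_bound.
assert (Hs0 : 0 <= sin t) by (apply sin_ge_0; lra).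
assert (Hs : sin t <= 1 / 2).
{ rewrite <- sin_PI6; apply sin_incr_1; lra. }
assert (Hc := COS_bound t).
assert (Hc0 : 0 <= cos t) by (apply cos_ge_0; lra).
assert (Ha := arcsin_coef_bound N).
assert (Hp : 0 <= sin t ^ (2 * N + 1) <= (1 / 4) ^ N).
{ split; [now apply pow_le|].
  rewrite pow_add, pow_mult.
  assert (0 <= sin t ^ 2 <= 1 / 4) by (simpl; nra).
  assert ((sin t ^ 2) ^ N <= (1 / 4) ^ N) by (now apply pow_incr).
  assert (0 <= (sin t ^ 2) ^ N) by (apply pow_le; lra).
  simpl (_ ^ 1); nra. }
rewrite S_INR.
rewrite Rabs_pos_eq.
- replace (4 * (INR N + 1) ^ 2) with ((2 * INR N + 2) ^ 2) by ring.
  apply Rmult_le_compat_l; [apply pow2_ge_0|].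
  assert (0 <= cos t * sin t ^ (2 * N + 1) <= (1 / 4) ^ N) by nra.
  nra.
- apply Rmult_le_pos; [apply pow2_ge_0|].
  apply Rmult_le_pos; [lra|]; apply Rmult_le_pos; lra.
Qed.

(** With constant weights the second derivative of the sum is the boundary term
    alone, and the initial data are those of [t]. *)
Lemma sum_mode_approx (N : nat) (t : R) : 0 <= t <= PI / 6 ->
  Rabs (sum_n (fun n => mode n t) N - t) <= tail_bound N.
Proof.
revert t.
apply (bound_of_derive2 _
  (fun t => sum_n (fun n => 1 * mode' n t) N - 1)
  (fun t => sum_n (fun n => 1 * mode'' n t) N)).
- exact PI6_le_1.
- intros u.
  apply (is_derive_minus (fun t => sum_n (fun n => mode n t) N) (fun t => t));
  [|apply (@is_derive_id R_AbsRing)].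
  apply is_derive_ext with (fun u => sum_n (fun n => 1 * mode n u) N).
  { intros v; apply sum_n_ext_R; intros n; ring. }
  apply (sum_n_derive (fun _ => 1)); intros n; apply mode_derive.
- intros u; evar_last.
  { apply (is_derive_minus (fun t => sum_n (fun n => 1 * mode' n t) N) (fun _ => 1)).
    - apply (sum_n_derive (fun _ => 1)); intros n; apply mode'_derive.
    - apply (@is_derive_const R_AbsRing). }
  unfold minus, plus, opp, zero; simpl; ring.
- rewrite (sum_n_ext_R _ (fun n => 1 * mode n 0)) by (intros n; ring).
  rewrite (sum_mode_0 (fun _ => 1)); ring.
- rewrite (sum_mode'_0 (fun _ => 1)); ring.
- intros u Hu; rewrite (sum_mode'' (fun _ => 1)).
  rewrite (sum_n_ext_R _ (fun _ => 0)) by (intros n; ring).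
  rewrite sum_n_const, Rmult_0_r, Rminus_0_l, Rabs_Ropp, Rmult_1_l.
  now apply mode_bound.
Qed.

Definition harmonic2 (n : nat) : R := sum_n_m (fun j : nat => 1 / INR j ^ 2) 1 n.

Lemma harmonic2_0 : harmonic2 0 = 0.
Proof. exact (sum_n_m_zero (fun j : nat => 1 / INR j ^ 2) 1 0 Nat.lt_0_1). Qed.

Lemma harmonic2_S (n : nat) : harmonic2 (S n) = harmonic2 n + 1 / INR (S n) ^ 2.
Proof.
exact (sum_n_Sm (fun j : nat => 1 / INR j ^ 2) 1 n (le_n_S 0 n (Nat.le_0_l n))).
Qed.

Lemma harmonic2_bound (n : nat) : 0 <= harmonic2 n <= INR n.
Proof.
induction n as [|n IH]; [rewrite harmonic2_0; simpl; lra|].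
rewrite harmonic2_S, S_INR; assert (Hn := pos_INR n).
assert (0 <= 1 / (INR n + 1) ^ 2 <= 1); [|lra].
split; [apply Rdiv_le_0_compat; nra|apply Rle_div_l; nra].
Qed.

(** The second derivative differs from [4 t = (2/3 t^3)''] by
    [4 * (sum_n mode n t - t)] and by a boundary term with the weight
    [harmonic2 (N+1) <= N+1]; both are bounded by multiples of [tail_bound N]. *)
Lemma sum_harmonic2_mode_approx (N : nat) (t : R) : 0 <= t <= PI / 6 ->
  Rabs (sum_n (fun n => harmonic2 n * mode n t) N - 2 / 3 * t ^ 3)
  <= (4 + INR (S N)) * tail_bound N.
Proof.
revert t.
apply (bound_of_derive2 _
  (fun t => sum_n (fun n => harmonic2 n * mode' n t) N - 2 * t ^ 2)
  (fun t => sum_n (fun n => harmonic2 n * mode'' n t) N - 4 * t)).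
- exact PI6_le_1.
- intros u.
  apply (is_derive_minus (fun t => sum_n (fun n => harmonic2 n * mode n t) N)
    (fun t => 2 / 3 * t ^ 3)).
  + apply sum_n_derive; intros n; apply mode_derive.
  + auto_derive; [exact I|field].
- intros u.
  apply (is_derive_minus (fun t => sum_n (fun n => harmonic2 n * mode' n t) N)
    (fun t => 2 * t ^ 2)).
  + apply sum_n_derive; intros n; apply mode'_derive.
  + auto_derive; [exact I|ring].
- rewrite sum_mode_0; ring.
- rewrite sum_mode'_0, harmonic2_0; ring.
- intros u Hu; rewrite sum_mode''.
  rewrite (sum_n_ext_R _ (fun n => 4 * mode n u)).
  2:{ intros n; rewrite harmonic2_S, S_INR; assert (Hn := pos_INR n).
      field; lra. }
  rewrite sum_n_mult_l_R.
  assert (H1 := sum_mode_approx N u Hu).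
  assert (H2 := mode_bound N u Hu).
  assert (H3 := harmonic2_bound (S N)).
  replace (_ - _ - 4 * u) with
    (4 * (sum_n (fun n => mode n u) N - u)
     + - (harmonic2 (S N) * ((2 * INR N + 2) ^ 2 * mode N u))) by ring.
  eapply Rle_trans; [apply Rabs_triang|].
  rewrite Rabs_Ropp, !Rabs_mult, (Rabs_pos_eq 4) by lra.
  rewrite (Rabs_pos_eq (harmonic2 (S N))) by lra.
  rewrite <- Rabs_mult.
  assert (H4 := Rabs_pos ((2 * INR N + 2) ^ 2 * mode N u)).
  nra.
Qed.

(** The cubic factor is absorbed by Bernoulli's inequality
    [1 + N/2 <= (3/2) ^ N], whose cube [(27/8) ^ N] is still beaten by [4 ^ N]. *)
Lemma tail_bound_lim : is_lim_seq (fun N => (4 + INR (S N)) * tail_bound N) 0.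
Proof.
apply is_lim_seq_le_le with (fun _ => 0) (fun N => 160 * (27 / 32) ^ N).
- intros N; unfold tail_bound; rewrite S_INR; assert (Hn := pos_INR N).
  assert (Hq : 0 <= (1 / 4) ^ N) by (apply pow_le; lra).
  split.
  + assert (0 <= 4 * (INR N + 1) ^ 2) by nra.
    apply Rmult_le_pos; [lra|]; now apply Rmult_le_pos.
  + assert (Hb : INR N + 1 <= 2 * (3 / 2) ^ N).
    { assert (Hp := poly N (1 / 2) ltac:(lra)).
      replace (1 + 1 / 2) with (3 / 2) in Hp by lra; lra. }
    assert (Hb3 : (INR N + 1) ^ 3 <= 8 * (27 / 8) ^ N).
    { replace (27 / 8) with ((3 / 2) ^ 3) by field.
      rewrite <- pow_mult, Nat.mul_comm, pow_mult.
      replace 8 with (2 ^ 3) by ring; rewrite <- Rpow_mult_distr.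
      apply pow_incr; lra. }
    replace (27 / 32) with (27 / 8 * (1 / 4)) by field.
    rewrite Rpow_mult_distr.
    (* 20 (N+1)^3 bounds the polynomial factor, since 4 + (N+1) <= 5 (N+1). *)
    apply Rle_trans with (20 * (INR N + 1) ^ 3 * (1 / 4) ^ N); [|nra].
    rewrite <- Rmult_assoc; apply Rmult_le_compat_r; [exact Hq|].
    assert (0 <= (INR N + 1) ^ 2) by nra.
    replace ((INR N + 1) ^ 3) with ((INR N + 1) * (INR N + 1) ^ 2) by ring.
    nra.
- apply is_lim_seq_const.
- replace (Finite 0) with (Rbar_mult 160 0) by (simpl; f_equal; ring).
  apply is_lim_seq_scal_l, is_lim_seq_geom; rewrite Rabs_pos_eq; lra.
Qed.

(** * Evaluation at PI/6 *)

Lemma mode_PI6 (n : nat) :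
  mode n (PI / 6) = sqrt 3 / 4 / ((1 + 2 * INR n) * Binomial.C (2 * n) n).
Proof.
unfold mode, arcsin_coef; rewrite cos_PI6, sin_PI6, pow_add, pow_mult.
replace ((1 / 2) ^ 2) with (/ 4) by field.
rewrite pow_inv; simpl (_ ^ 1).
assert (HC := C_neq0 n); assert (Hn := pos_INR n).
field; repeat split; first [assumption | lra | apply pow_nonzero; lra].
Qed.

(* Series in Coquelicot start at index 0, so the outer index is i = S k.
   [Binomial.C] is the binomial coefficient ([C] alone is the complex field). *)
Theorem mainTheorem1 :
  is_series
    (fun k : nat =>
       let i := S k in
       sum_n_m (fun j : nat => 1 / INR j ^ 2) 1 i
         / ((1 + 2 * INR i) * Binomial.C (2 * i) i))
    (PI ^ 3 / (81 * sqrt 3)).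
Proof.
assert (Hs : 0 < sqrt 3) by (apply sqrt_lt_R0; lra).
assert (Hpi := PI_RGT_0).
assert (Hlim : is_series (fun n => harmonic2 n * mode n (PI / 6)) (2 / 3 * (PI / 6) ^ 3)).
{ apply (proj1 (is_lim_seq_spec (sum_n _) (2 / 3 * (PI / 6) ^ 3))).
  intros eps.
  destruct (proj2 (is_lim_seq_spec _ 0) tail_bound_lim eps) as [N0 HN0].
  exists N0; intros N HN; specialize (HN0 N HN).
  eapply Rle_lt_trans; [apply sum_harmonic2_mode_approx; lra|].
  rewrite Rminus_0_r in HN0; apply Rle_lt_trans with (2 := HN0), Rle_abs. }
assert (Hterm : forall k, 4 / sqrt 3 * (harmonic2 (S k) * mode (S k) (PI / 6))
  = harmonic2 (S k) / ((1 + 2 * INR (S k)) * Binomial.C (2 * S k) (S k))).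
{ intros k; rewrite mode_PI6.
  assert (HC := C_neq0 (S k)); assert (Hn := pos_INR (S k)).
  field; repeat split; assumption || lra. }
apply (is_series_ext _ _ _ Hterm).
(* The term of index 0, absent from the stated series, vanishes with harmonic2 0. *)
apply (is_series_incr_1 (fun n => 4 / sqrt 3 * (harmonic2 n * mode n (PI / 6)))).
evar_last; [exact (is_series_scal (4 / sqrt 3) _ _ Hlim)|].
change (4 / sqrt 3 * (2 / 3 * (PI / 6) ^ 3)
  = PI ^ 3 / (81 * sqrt 3) + 4 / sqrt 3 * (harmonic2 0 * mode 0 (PI / 6))).
rewrite harmonic2_0; field; lra.
Qed.
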